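(* Let $\ell$ be a prime and let $\alpha\in\mathbb{Q}_\ell$ be an element whose Ruban continued fraction expansion is periodic. Then $\alpha$ is either rational, or quadratic irrational over $\mathbb{Q}$ and such that the field $\mathbb{Q}(\alpha)$ can be embedded in $\mathbb{R}$.
   Context: Let $\ell$ be a prime, $v$ the $\ell$-adic valuation on $\mathbb{Q}_\ell$ and $|x|_\ell=\ell^{-v(x)}$. For $\alpha\in\mathbb{Q}_\ell$ the $\ell$-adic integral part $\lfloor\alpha\rfloor_\ell$ is the unique $a\in\mathbb{Z}[1/\ell]$ with $0\le a<\ell$ and $|\alpha-a|_\ell<1$. The Ruban continued fraction expansion of $\alpha$ is defined by $\alpha_0:=\alpha$, $a_n:=\lfloor\alpha_n\rfloor_\ell$, $r_n:=\alpha_n-a_n$, and $\alpha_{n+1}:=1/r_n$ whenever $r_n\neq 0$; if $r_n=0$ for some $n$ the procedure stops. The $a_n$ are the partial quotients and the $\alpha_n$ the complete quotients. ''Periodic'' means infinite and eventually periodic: there are $N\ge 0$ and $k\ge 1$ with $a_{n+k}=a_n$ for all $n\ge N$. *)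

(* Defs.v *)
From HB Require Import structures.
From mathcomp Require Import all_boot all_order all_algebra.
From mathcomp Require Import ring_quotient generic_quotient.
From mathcomp Require Import boolp classical_sets functions.
From mathcomp Require Import ring lra zify.

Set Implicit Arguments.
Unset Strict Implicit.
Unset Printing Implicit Defensive.

Import Order.TTheory GRing.Theory Num.Theory.
Local Open Scope ring_scope.
Local Open Scope quotient_scope.

Section RatAbs.
Variable l : nat.
Hypothesis l_prime : prime l.

(* rat_val 0 is a junk value; rat_abs 0 is set separately. *)
Definition rat_val (x : rat) : int :=
  (logn l `|numq x|)%:Z - (logn l `|denq x|)%:Z.

Definition rat_abs (x : rat) : rat :=
  if x == 0 then 0 else l%:R ^ (- rat_val x).

Let l_gt0 : 0 < l%:R :> rat.
Proof. by rewrite ltr0n prime_gt0. Qed.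
Let l_neq0 : l%:R != 0 :> rat.
Proof. by rewrite gt_eqF. Qed.
Let l_gt1 : 1 < l%:R :> rat.
Proof. by rewrite ltr1n prime_gt1. Qed.

Lemma rat_abs0 : rat_abs 0 = 0.
Proof. by rewrite /rat_abs eqxx. Qed.

Lemma rat_val_frac (n d : int) : n != 0 -> d != 0 ->
  rat_val (n%:~R / d%:~R) = (logn l `|n|)%:Z - (logn l `|d|)%:Z.
Proof.
move=> n0 d0; rewrite /rat_val; set x := _ / _.
have x0 : x != 0 by rewrite mulf_neq0 ?invr_eq0 ?intr_eq0.
have e : n * denq x = numq x * d.
  apply: (@intr_inj rat); rewrite !rmorphM /=.
  have : x = (numq x)%:~R / (denq x)%:~R by rewrite divq_num_den.
  have hd : (denq x)%:~R != 0 :> rat by rewrite intr_eq0 denq_neq0.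
  have hd' : d%:~R != 0 :> rat by rewrite intr_eq0.
  rewrite {1}/x => /eqP; rewrite eqr_div // => /eqP //.
have /(congr1 (fun z : int => logn l `|z|)) := e.
rewrite !abszM !lognM ?absz_gt0 ?denq_neq0 ?numq_eq0 //.
lia.
Qed.

Lemma rat_abs_frac (n d : int) : n != 0 -> d != 0 ->
  rat_abs (n%:~R / d%:~R) = l%:R ^ ((logn l `|d|)%:Z - (logn l `|n|)%:Z).
Proof.
move=> n0 d0; rewrite /rat_abs rat_val_frac // opprB ifN //.
by rewrite mulf_neq0 ?invr_eq0 ?intr_eq0.
Qed.

Lemma rat_abs_gt0 x : x != 0 -> 0 < rat_abs x.
Proof. by move=> x0; rewrite /rat_abs ifN // exprz_gt0. Qed.

Lemma rat_abs_ge0 x : 0 <= rat_abs x.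
Proof.
by have [->|/rat_abs_gt0/ltW//] := eqVneq x 0; rewrite rat_abs0.
Qed.

Lemma rat_absM : {morph rat_abs : x y / x * y}.
Proof.
move=> x y; have [->|x0] := eqVneq x 0; first by rewrite mul0r rat_abs0 mul0r.
have [->|y0] := eqVneq y 0; first by rewrite mulr0 rat_abs0 mulr0.
rewrite -[x]divq_num_den -[y]divq_num_den mulf_div -!intrM.
rewrite !rat_abs_frac ?mulf_neq0 ?denq_neq0 ?numq_eq0 //.
rewrite -expfzDr // !abszM !lognM ?absz_gt0 ?denq_neq0 ?numq_eq0 //.
congr (_ ^ _); lia.
Qed.

Lemma rat_abs1 : rat_abs 1 = 1.
Proof.
have e : 1 = 1%:~R / 1%:~R :> rat by rewrite divr1.
by rewrite {1}e rat_abs_frac // subrr expr0z.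
Qed.

Lemma rat_absV x : rat_abs x^-1 = (rat_abs x)^-1.
Proof.
have [->|x0] := eqVneq x 0; first by rewrite !(invr0, rat_abs0).
apply: (mulfI (lt0r_neq0 (rat_abs_gt0 x0))).
by rewrite -rat_absM !divff ?rat_abs1 // lt0r_neq0 // rat_abs_gt0.
Qed.

Lemma rat_absN x : rat_abs (- x) = rat_abs x.
Proof. by rewrite /rat_abs /rat_val oppr_eq0 numqN denqN abszN. Qed.

Lemma rat_absD_max x y : rat_abs (x + y) <= Num.max (rat_abs x) (rat_abs y).
Proof.
have [->|x0] := eqVneq x 0; first by rewrite add0r le_max lexx orbT.
have [->|y0] := eqVneq y 0; first by rewrite addr0 le_max lexx.
have [->|xy0] := eqVneq (x + y) 0; first by rewrite rat_abs0 le_max rat_abs_ge0.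
pose d := denq x * denq y.
have d0 : d != 0 by rewrite mulf_neq0 ?denq_neq0.
have ddx : (denq x)%:~R != 0 :> rat by rewrite intr_eq0 denq_neq0.
have ddy : (denq y)%:~R != 0 :> rat by rewrite intr_eq0 denq_neq0.
have ex : x = (numq x * denq y)%:~R / d%:~R.
  by rewrite -{1}[x]divq_num_den /d !intrM; field; rewrite ddx ddy.
have ey : y = (numq y * denq x)%:~R / d%:~R.
  by rewrite -{1}[y]divq_num_den /d !intrM; field; rewrite ddx ddy.
move: ex ey; set a := (_ * denq y); set b := (numq y * _) => ex ey.
have exy : x + y = (a + b)%:~R / d%:~R by rewrite intrD mulrDl -ex -ey.
have d0' : d%:~R != 0 :> rat by rewrite intr_eq0.
have a0 : a != 0 by apply: contraNneq x0 => e; rewrite ex e mul0r.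
have b0 : b != 0 by apply: contraNneq y0 => e; rewrite ey e mul0r.
have ab0 : a + b != 0 by apply: contraNneq xy0 => e; rewrite exy e mul0r.
rewrite exy ex ey !rat_abs_frac // le_max !ler_eXz2l //.
have : (minn (logn l `|a|) (logn l `|b|) <= logn l `|(a + b)%R|)%N.
  rewrite -pfactor_dvdn ?absz_gt0 //.
  rewrite -[X in (X %| _)%N]/(`|(_ : nat)%:Z|%N) -dvdzE.
  rewrite rpredD // dvdzE /= pfactor_dvdn ?absz_gt0 //; lia.
lia.
Qed.

Lemma rat_absD_lt x y e : rat_abs x < e -> rat_abs y < e -> rat_abs (x + y) < e.
Proof.
by move=> xe ye; apply: le_lt_trans (rat_absD_max x y) _; rewrite gt_max xe.
Qed.

Lemma rat_absB_lt x y e : rat_abs x < e -> rat_abs y < e -> rat_abs (x - y) < e.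
Proof. by move=> xe ye; apply: rat_absD_lt; rewrite ?rat_absN. Qed.

Lemma rat_absBC x y : rat_abs (x - y) = rat_abs (y - x).
Proof. by rewrite -rat_absN opprB. Qed.

Lemma rat_abs_eq x y : rat_abs (x - y) < rat_abs y -> rat_abs x = rat_abs y.
Proof.
move=> h; apply/eqP; rewrite eq_le; apply/andP; split.
  have := rat_absD_max (x - y) y; rewrite subrK => /le_trans; apply.
  by rewrite ge_max (ltW h) lexx.
rewrite leNgt; apply/negP => h'.
have := rat_absB_lt h' h.
by rewrite opprB addrC subrK ltxx.
Qed.

Definition padic_cauchy (u : nat -> rat) : Prop :=
  forall e : rat, 0 < e -> exists N : nat,
    forall m n, (N <= m)%N -> (N <= n)%N -> rat_abs (u m - u n) < e.

Definition padic_null (u : nat -> rat) : Prop :=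
  forall e : rat, 0 < e -> exists N : nat,
    forall n, (N <= n)%N -> rat_abs (u n) < e.

Lemma cauchy_bounded u : padic_cauchy u ->
  exists2 M, 0 < M & forall n, rat_abs (u n) < M.
Proof.
move=> /(_ 1 ltr01)[N uN].
pose M := 1 + \sum_(i < N.+1) rat_abs (u i).
have s0 : 0 <= \sum_(i < N.+1) rat_abs (u i).
  by rewrite sumr_ge0 // => i _; exact: rat_abs_ge0.
have M1 : 1 <= M by rewrite lerDl.
have hM n : (n <= N)%N -> rat_abs (u n) < M.
  move=> nN; rewrite /M (bigD1 (Ordinal (nN : (n < N.+1)%N))) //=.
  rewrite addrCA ltrDl ltr_pwDl // sumr_ge0 // => i _; exact: rat_abs_ge0.
exists M => [|n]; first exact: lt_le_trans M1.
have [/hM//|Nn] := leqP n N.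
rewrite -[u n](subrK (u N)); apply: rat_absD_lt (hM _ (leqnn _)).
exact: lt_le_trans (uN _ _ (ltnW Nn) (leqnn _)) M1.
Qed.

Lemma null_cauchyM u v : padic_cauchy u -> padic_null v ->
  padic_null (fun n => u n * v n).
Proof.
move=> /cauchy_bounded[M M0 uM] v0 e e0.
have [N vN] := v0 (e / M) (divr_gt0 e0 M0); exists N => n /vN vn.
rewrite rat_absM -[e](divfK (lt0r_neq0 M0)) [_ * M]mulrC.
apply: ltr_pM; rewrite ?rat_abs_ge0 //; exact: uM.
Qed.

Lemma null_D u v : padic_null u -> padic_null v ->
  padic_null (fun n => u n + v n).
Proof.
move=> u0 v0 e e0; have [N uN] := u0 e e0; have [N' vN] := v0 e e0.
exists (maxn N N') => n; rewrite geq_max => /andP[/uN h1 /vN h2].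
exact: rat_absD_lt.
Qed.

Lemma cauchyB u v : padic_cauchy u -> padic_cauchy v ->
  padic_cauchy (fun n => u n - v n).
Proof.
move=> uc vc e e0; have [N uN] := uc e e0; have [N' vN] := vc e e0.
exists (maxn N N') => m n; rewrite !geq_max => /andP[m1 m2] /andP[n1 n2].
have -> : (u m - v m) - (u n - v n) = (u m - u n) - (v m - v n) by ring.
by apply: rat_absB_lt; [exact: uN | exact: vN].
Qed.

Lemma cauchyM u v : padic_cauchy u -> padic_cauchy v ->
  padic_cauchy (fun n => u n * v n).
Proof.
move=> uc vc e e0.
have [M M0 uM] := cauchy_bounded uc; have [M' M'0 vM] := cauchy_bounded vc.
have [N uN] := uc _ (divr_gt0 e0 M'0); have [N' vN] := vc _ (divr_gt0 e0 M0).
exists (maxn N N') => m n; rewrite !geq_max => /andP[m1 m2] /andP[n1 n2].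
have -> : u m * v m - u n * v n = (u m - u n) * v m + (v m - v n) * u n by ring.
apply: rat_absD_lt; rewrite rat_absM.
  rewrite -[e](divfK (lt0r_neq0 M'0)).
  by apply: ltr_pM; rewrite ?rat_abs_ge0 //; exact: uN.
rewrite -[e](divfK (lt0r_neq0 M0)).
by apply: ltr_pM; rewrite ?rat_abs_ge0 //; exact: vN.
Qed.

Lemma cauchy_lower u : padic_cauchy u -> ~ padic_null u ->
  exists N : nat, exists2 c, 0 < c & forall n, (N <= n)%N -> rat_abs (u n) = c.
Proof.
move=> uc; apply: contra_notP => H e e0.
have [N uN] := uc e e0; exists N => n Nn; rewrite ltNge; apply/negP => en.
apply: H; exists N, (rat_abs (u n)); first exact: lt_le_trans en.
move=> m Nm; apply: rat_abs_eq; exact: lt_le_trans (uN _ _ Nm Nn) en.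
Qed.

End RatAbs.

(* The unused argument l_prime is needed by the ring and field instances below,
   which are inferred from the type. *)
Definition cauchy_pred (l : nat) (l_prime : prime l) : {pred nat -> rat} :=
  fun u => `[< padic_cauchy l u >].

Section Padic.
Variables (l : nat) (l_prime : prime l).
Local Notation cauchy_pred := (cauchy_pred l_prime).

Lemma cauchy_subring : subring_closed cauchy_pred.
Proof.
split=> [|u v /asboolP uc /asboolP vc|u v /asboolP uc /asboolP vc].
- apply/asboolP => e e0; exists 0%N => m n _ _.
  by rewrite subrr rat_abs0.
- exact/asboolP/(cauchyB l_prime uc vc).
- exact/asboolP/(cauchyM l_prime uc vc).
Qed.

HB.instance Definition _ :=
  GRing.isSubringClosed.Build (nat -> rat) cauchy_pred cauchy_subring.

Record cauchy_seq := CauchySeq {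
  cauchy_val :> nat -> rat;
  cauchy_valP : cauchy_val \in cauchy_pred }.

HB.instance Definition _ := [isSub for cauchy_val].
HB.instance Definition _ := [Choice of cauchy_seq by <:].
HB.instance Definition _ := [SubChoice_isSubComNzRing of cauchy_seq by <:].

Definition null_ideal : {pred cauchy_seq} := fun u => `[< padic_null l u >].

Lemma null_idealP : idealr_closed null_ideal.
Proof.
split.
- by apply/asboolP => e e0; exists 0%N => n _; rewrite rat_abs0.
- apply/asboolP => /(_ 1 ltr01)[N uN].
  have h : rat_abs l (1 : rat) < 1 := uN N (leqnn N).
  by rewrite (rat_abs1 l_prime) ltxx in h.
- move=> a u v /asboolP u0 /asboolP v0; apply/asboolP.
  have ac : padic_cauchy l a by exact/asboolP/(cauchy_valP a).
  exact: (null_D l_prime (null_cauchyM l_prime ac u0) v0).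
Qed.

HB.instance Definition _ := isIdealr.Build cauchy_seq null_ideal null_idealP.

(* Q_l as the completion of Q: l-adic Cauchy sequences of rationals modulo the
   sequences tending to 0. *)
Definition padic := {ideal_quot null_ideal}.

HB.instance Definition _ := GRing.ComNzRing.on padic.

Lemma padic_pi_eq0 (u : cauchy_seq) : \pi_padic u = 0 <-> padic_null l u.
Proof.
have e : (\pi_padic u == 0) = (u \in null_ideal).
  by rewrite -[X in _ == X](rmorph0 \pi_padic) -Quotient.idealrBE subr0.
split=> [/eqP|u0]; first by rewrite e => /asboolP.
by apply/eqP; rewrite e; apply/asboolP.
Qed.

Definition padic_inv (x : padic) : padic := xget 0 [set y | y * x = 1]%classic.

Lemma padic_inv0 : padic_inv 0 = 0.
Proof.
rewrite /padic_inv; case: xgetP => // y _ /=.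
by rewrite mulr0 => /esym/eqP; rewrite oner_eq0.
Qed.

Lemma padic_mulVf x : x != 0 -> padic_inv x * x = 1.
Proof.
move=> x0; rewrite /padic_inv.
apply: (@xgetPex _ 0 [set y | y * x = 1]%classic) => /=.
move: x0; elim/quotW: x => u /eqP; rewrite padic_pi_eq0 => u0.
have uc : padic_cauchy l u by exact/asboolP/(cauchy_valP u).
have [N [c c0 uN]] := cauchy_lower l_prime uc u0.
have uneq0 n : (N <= n)%N -> u n != 0.
  by move=> /uN un; apply: contraTneq c0 => e; rewrite -un e rat_abs0 ltxx.
have vc : (fun n => (u n)^-1) \in cauchy_pred.
  apply/asboolP => e e0.
  have [N' uN'] := uc (e * (c * c)) (mulr_gt0 e0 (mulr_gt0 c0 c0)).
  exists (maxn N N') => m n; rewrite !geq_max => /andP[m1 m2] /andP[n1 n2].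
  have um0 := uneq0 _ m1; have un0 := uneq0 _ n1.
  have -> : (u m)^-1 - (u n)^-1 = (u n - u m) / (u m * u n).
    by field; rewrite um0 un0.
  by rewrite rat_absM // rat_absV // rat_absM // !uN // ltr_pdivrMr ?mulr_gt0 //
    uN'.
exists (\pi_padic (CauchySeq vc)).
rewrite -[RHS](rmorph1 \pi_padic) -rmorphM; apply/eqP; rewrite -subr_eq0 -rmorphB.
apply/eqP/padic_pi_eq0 => e e0; exists N => n /uneq0 un0.
have -> : cauchy_val (CauchySeq vc * u - 1) n = (u n)^-1 * u n - 1 by [].
by rewrite mulVf // subrr rat_abs0.
Qed.

HB.instance Definition _ :=
  GRing.ComNzRing_isField.Build padic padic_mulVf padic_inv0.

Lemma const_cauchy (q : rat) : (fun _ : nat => q) \in cauchy_pred.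
Proof.
by apply/asboolP => e e0; exists 0%N => m n _ _; rewrite subrr rat_abs0.
Qed.

Definition padic_of_rat (q : rat) : padic :=
  \pi_padic (CauchySeq (const_cauchy q)).

Lemma padic_of_rat_zmod : zmod_morphism padic_of_rat.
Proof.
by move=> p q; rewrite /padic_of_rat -rmorphB; congr (\pi _); apply: val_inj.
Qed.

Lemma padic_of_rat_monoid : monoid_morphism padic_of_rat.
Proof.
split=> [|p q].
  by rewrite -[RHS](rmorph1 \pi_padic); congr (\pi _); apply: val_inj.
by rewrite /padic_of_rat -rmorphM; congr (\pi _); apply: val_inj.
Qed.

HB.instance Definition _ :=
  GRing.isZmodMorphism.Build rat padic padic_of_rat padic_of_rat_zmod.
HB.instance Definition _ :=
  GRing.isMonoidMorphism.Build rat padic padic_of_rat padic_of_rat_monoid.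

Lemma padic_ratrE (q : rat) : ratr q = padic_of_rat q.
Proof. by rewrite (fmorph_eq_rat padic_of_rat). Qed.

Definition rat_seq_lim (v : nat -> rat) (r : rat) : Prop :=
  forall e : rat, 0 < e -> exists N : nat, forall n, (N <= n)%N -> `|v n - r| < e.

Definition padic_abs (x : padic) : rat :=
  xget 0 [set r | rat_seq_lim (fun n => rat_abs l (repr x n)) r]%classic.

Lemma rat_seq_lim_unique v r s : rat_seq_lim v r -> rat_seq_lim v s -> r = s.
Proof.
move=> vr vs; apply/eqP; rewrite -subr_eq0 -normr_le0 leNgt; apply/negP => h.
have h2 : 0 < `|r - s| / 2 by lra.
have [N rN] := vr _ h2; have [N' sN] := vs _ h2.
have := rN (maxn N N') (leq_maxl _ _); have := sN (maxn N N') (leq_maxr _ _).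
have := ler_normB (v (maxn N N') - s) (v (maxn N N') - r).
have -> : v (maxn N N') - s - (v (maxn N N') - r) = r - s by ring.
lra.
Qed.

(* The sequence of absolute values is eventually constant unless the limit
   is 0, which is why a rational limit always exists. *)
Lemma padic_absP (u : cauchy_seq) :
  rat_seq_lim (fun n => rat_abs l (u n)) (padic_abs (\pi_padic u)).
Proof.
set x := \pi_padic u.
have uc : padic_cauchy l u by exact/asboolP/(cauchy_valP u).
have xc : padic_cauchy l (repr x) by exact/asboolP/(cauchy_valP (repr x)).
have [x0|x0] := eqVneq x 0.
  have r0 v : \pi_padic v = 0 -> rat_seq_lim (fun n => rat_abs l (v n)) 0.
    move=> /padic_pi_eq0 v0 e e0; have [N vN] := v0 e e0; exists N => n /vN.
    by rewrite subr0 ger0_norm ?rat_abs_ge0.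
  have -> : padic_abs x = 0; last exact: r0.
  apply: xget_unique => [|s /= sl]; first by apply: r0; rewrite reprK.
  by apply: rat_seq_lim_unique sl _; apply: r0; rewrite reprK.
have rn : ~ padic_null l (repr x).
  by move=> /padic_pi_eq0; rewrite reprK => /eqP; apply/negP.
have [N [c c0 rN]] := cauchy_lower l_prime xc rn.
have rl : rat_seq_lim (fun n => rat_abs l (repr x n)) c.
  by move=> e e0; exists N => n /rN ->; rewrite subrr normr0.
have -> : padic_abs x = c.
  by apply: xget_unique => [//|s /= /rat_seq_lim_unique]; apply.
have d0 : padic_null l (u - repr x : cauchy_seq).
  by apply/padic_pi_eq0; rewrite rmorphB /= reprK subrr.
have [N' dN] := d0 c c0.
move=> e e0; exists (maxn N N') => n; rewrite geq_max => /andP[n1 n2].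
have h : rat_abs l (u n - repr x n) < rat_abs l (repr x n).
  by rewrite rN //; apply: dN.
by rewrite (rat_abs_eq l_prime h) rN // subrr normr0.
Qed.

Lemma padic_abs_lim (u : cauchy_seq) r :
  rat_seq_lim (fun n => rat_abs l (u n)) r -> padic_abs (\pi_padic u) = r.
Proof. exact: rat_seq_lim_unique (padic_absP u). Qed.

Lemma padic_abs_rat (q : rat) : padic_abs (ratr q) = rat_abs l q.
Proof.
rewrite padic_ratrE; apply: padic_abs_lim => e e0.
by exists 0%N => n _; rewrite subrr normr0.
Qed.

Lemma padic_abs_eventually (u : cauchy_seq) (e : rat) :
  padic_abs (\pi_padic u) < e <->
  0 < e /\ exists N : nat, exists2 c, c < e &
    forall n, (N <= n)%N -> rat_abs l (u n) <= c.
Proof.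
have ul := padic_absP u; set r := padic_abs _ in ul *.
split=> [re|[e0 [N [c ce uN]]]].
  have re2 : 0 < (e - r) / 2 by lra.
  have [N uN] := ul _ re2; split.
    have := uN N (leqnn _); have := rat_abs_ge0 l_prime (u N).
    by rewrite ltr_norml => h /andP[]; lra.
  exists N, ((e + r) / 2); first lra.
  by move=> n /uN; rewrite ltr_norml => /andP[]; lra.
rewrite ltNge; apply/negP => er.
have h : 0 < r - c by lra.
have [N' uN'] := ul _ h.
have := uN' _ (leq_maxr N N'); have := uN _ (leq_maxl N N').
by rewrite ltr_norml => h1 /andP[]; lra.
Qed.

Lemma padic_absD_lt x y e :
  padic_abs x < e -> padic_abs y < e -> padic_abs (x + y) < e.
Proof.
elim/quotW: x => u; elim/quotW: y => v; rewrite -rmorphD.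
move=> /padic_abs_eventually[e0 [N [c ce uN]]].
move=> /padic_abs_eventually[_ [N' [c' ce' vN]]].
apply/padic_abs_eventually; split=> //.
exists (maxn N N'), (Num.max c c'); first by rewrite gt_max ce.
move=> n; rewrite geq_max => /andP[n1 n2].
apply: le_trans (rat_absD_max l_prime (u n) (v n)) _.
by rewrite ge_max !le_max uN // vN // orbT.
Qed.

Lemma padic_absN x : padic_abs (- x) = padic_abs x.
Proof.
elim/quotW: x => u; rewrite -rmorphN; apply: padic_abs_lim => e e0.
have [N uN] := padic_absP u e0; exists N => n /uN.
by have -> : rat_abs l ((- u : cauchy_seq) n) = rat_abs l (u n) by exact: rat_absN.
Qed.

Lemma padic_rat_dense x (e : rat) : 0 < e ->
  exists q : rat, padic_abs (x - ratr q) < e.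
Proof.
move=> e0; elim/quotW: x => u.
have uc : padic_cauchy l u by exact/asboolP/(cauchy_valP u).
have e2 : 0 < e / 2 by lra.
have [N uN] := uc _ e2; exists (u N); rewrite padic_ratrE -rmorphB.
apply/padic_abs_eventually; split=> //; exists N, (e / 2); first lra.
by move=> n Nn; apply/ltW/uN.
Qed.

End Padic.

Section Ruban.
Variables (l : nat) (l_prime : prime l).
Local Notation padic := (padic l_prime).

(* Membership in Z[1/l]. *)
Definition l_integer (a : rat) : Prop :=
  exists (m : int) (k : nat), a = m%:~R / l%:R ^+ k.

Definition is_padic_floor (x : padic) (a : rat) : Prop :=
  [/\ l_integer a, 0 <= a, a < l%:R & padic_abs (x - ratr a) < 1].

(* See padic_floor_unique and padic_floorP: the default value is never used. *)
Definition padic_floor (x : padic) : rat :=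
  xget 0 [set a | is_padic_floor x a]%classic.

Let l_gt0 : 0 < l%:R :> rat.
Proof. by rewrite ltr0n prime_gt0. Qed.
Let l_neq0 : l%:R != 0 :> rat.
Proof. by rewrite gt_eqF. Qed.
Let l_gt1 : 1 < l%:R :> rat.
Proof. by rewrite ltr1n prime_gt1. Qed.

Lemma padic_floor_unique x a b :
  is_padic_floor x a -> is_padic_floor x b -> a = b.
Proof.
wlog ab : a b / a <= b => [H ha hb|].
  by case/orP: (le_total a b) => h; [|symmetry]; apply: H h _ _.
move=> [[m [k ea]] a0 al xa] [[m' [k' eb]] b0 bl xb].
apply/eqP; rewrite eq_sym -subr_eq0; apply/negPn/negP => d0.
have eab : b - a = (m' * (l ^ k)%N - m * (l ^ k')%N)%:~R / l%:R ^+ (k + k').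
  rewrite intrB !intrM -!pmulrn !natrX exprD ea eb.
  have h1 : l%:R ^+ k != 0 :> rat by rewrite expf_neq0.
  have h2 : l%:R ^+ k' != 0 :> rat by rewrite expf_neq0.
  by field; rewrite h1 h2.
have : padic_abs (ratr (b - a) : padic) < 1.
  have -> : ratr (b - a) = (x - ratr a) - (x - ratr b) :> padic.
    by rewrite !padic_ratrE rmorphB; ring.
  by apply: padic_absD_lt => //; rewrite padic_absN.
rewrite padic_abs_rat eab.
set n : int := (_ - _)%R in eab *; set K := (k + k')%N in eab *.
have n0 : n != 0 by apply: contraNneq d0 => e; rewrite eab e mul0r.
have lK0 : (l ^ K)%N%:Z != 0 by rewrite -lt0n expn_gt0 prime_gt0.
have eK : l%:R ^+ K = ((l ^ K)%N%:Z)%:~R :> rat by rewrite -pmulrn natrX.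
rewrite {1}eK rat_abs_frac // pfactorK // -(expr0z (l%:R : rat)) ltr_eXz2l // => lt.
have : (l ^ K.+1 %| `|n|)%N by rewrite pfactor_dvdn ?absz_gt0 //; lia.
move=> /dvdn_leq; rewrite absz_gt0 => /(_ n0) le.
have : b - a < l%:R by rewrite ltrBlDr (lt_le_trans bl) // lerDl.
have n_ge0 : 0 <= n.
  have : 0 <= b - a by rewrite subr_ge0.
  by rewrite eab pmulr_lge0 ?invr_gt0 ?exprn_gt0 // ler0z.
rewrite eab ltr_pdivrMr ?exprn_gt0 // -exprS -natrX -[n]gez0_abs // -pmulrn ltr_nat.
by rewrite ltnNge le.
Qed.

Lemma padic_floor_exists x : exists a, is_padic_floor x a.
Proof.
have [q hq] := padic_rat_dense x ltr01.
suff [a [ha a0 al qa]] : exists a, [/\ l_integer a, 0 <= a, a < l%:R &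
    rat_abs l (q - a) < 1].
  exists a; split=> //.
  have -> : x - ratr a = (x - ratr q) + ratr (q - a).
    by rewrite !padic_ratrE rmorphB; ring.
  by apply: padic_absD_lt => //; rewrite padic_abs_rat.
pose d := `|denq q|%N; have d_gt0 : (0 < d)%N by rewrite absz_gt0 denq_neq0.
pose k := logn l d; pose b := (d %/ l ^ k)%N.
have ed : d = (b * l ^ k)%N by rewrite divnK // pfactor_dvdnn.
have b_gt0 : (0 < b)%N by move: d_gt0; rewrite ed muln_gt0 => /andP[].
have bl : coprime b (l ^ k.+1).
  rewrite coprime_sym coprime_pexpl // prime_coprime //.
  apply/negP => lb; have : (l ^ k.+1 %| d)%N.
    by rewrite ed expnS dvdn_mul.
  by rewrite pfactor_dvdn // ltnn.
pose M := (l ^ k.+1)%N.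
have M_gt0 : (0 < M)%N by rewrite expn_gt0 prime_gt0.
have [[u v] /= euv] : exists uv : int * int, uv.1 * b%:Z + uv.2 * M%:Z = 1.
  have [u [v e]] := Bezoutz b%:Z M%:Z.
  by exists (u, v); rewrite /= e /gcdz /= (eqP bl).
pose c := ((numq q * u) %% M%:Z)%Z.
have c0 : 0 <= c by rewrite modz_ge0 // -lt0n.
have cM : c < M%:Z by rewrite ltz_pmod.
have lk0 : l%:R ^+ k != 0 :> rat by rewrite expf_neq0.
exists (c%:~R / l%:R ^+ k); split.
- by exists c, k.
- by rewrite divr_ge0 ?exprn_ge0 ?ler0z // ltW.
- by rewrite ltr_pdivrMr ?exprn_gt0 // -exprS -natrX pmulrn ltr_int.
have b0 : b%:R != 0 :> rat by rewrite pnatr_eq0 -lt0n.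
have eq : q - c%:~R / l%:R ^+ k = (numq q - c * b%:Z)%:~R / (d%:Z)%:~R.
  have {1}-> : q = (numq q)%:~R / (b%:R * l%:R ^+ k).
    by rewrite -natrX -natrM -ed pmulrn /d gez0_abs ?divq_num_den.
  rewrite ed intrB intrM -!pmulrn natrM natrX.
  by field; rewrite b0 lk0.
have [n0|n0] := eqVneq (numq q - c * b%:Z) 0; first by rewrite eq n0 mul0r rat_abs0.
have d0 : d%:Z != 0 by rewrite -lt0n.
rewrite eq rat_abs_frac //= -(expr0z (l%:R : rat)) ltr_eXz2l // subr_lt0 ltz_nat.
rewrite -pfactor_dvdn ?absz_gt0 // -/M.
have -> : numq q - c * b%:Z =
    M%:Z * (numq q * v + ((numq q * u) %/ M%:Z)%Z * b%:Z).
  have e := divz_eq (numq q * u) M%:Z; rewrite -/c in e.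
  have -> : c = numq q * u - ((numq q * u) %/ M%:Z)%Z * M%:Z.
    by rewrite {1}e addrAC subrr add0r.
  rewrite -{1}[numq q]mulr1 -euv; ring.
by rewrite abszM dvdn_mulr.
Qed.

Lemma padic_floorP x : is_padic_floor x (padic_floor x).
Proof. exact: xgetPex (padic_floor_exists x). Qed.

(* None means that the expansion has stopped before index n. *)
Fixpoint ruban_complete_quotient (x : padic) (n : nat) : option padic :=
  if n is n'.+1 then
    if ruban_complete_quotient x n' is Some y then
      let r := y - ratr (padic_floor y) in
      if r == 0 then None else Some r^-1
    else None
  else Some x.

Definition ruban_partial_quotient (x : padic) (n : nat) : option rat :=
  omap padic_floor (ruban_complete_quotient x n).

Definition ruban_infinite (x : padic) : Prop :=
  forall n, ruban_partial_quotient x n <> None.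

Definition ruban_periodic (x : padic) : Prop :=
  ruban_infinite x /\
  exists N k : nat, (1 <= k)%N /\ forall n, (N <= n)%N ->
    ruban_partial_quotient x (n + k) = ruban_partial_quotient x n.

End Ruban.

Section RationalAdjoin.
Variables (K : fieldType) (x : K).

Definition is_rational : Prop := exists q : rat, x = ratr q.

Definition is_quadratic_irrational : Prop :=
  exists p : {poly rat},
    [/\ size p = 3%N, irreducible_poly p & root (map_poly ratr p) x].

(* The intersection of all subfields of K that contain x; when K has
   characteristic 0 this is Q(x). *)
Definition adjoin_pred : {pred K} := fun y =>
  `[< forall S : {pred K}, divring_closed S -> x \in S -> y \in S >].

Lemma adjoin_divring : divring_closed adjoin_pred.
Proof.
split=> [|y z /asboolP hy /asboolP hz|y z /asboolP hy /asboolP hz];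
  apply/asboolP => S Sc xS; case: (Sc) => S1 SB SV.
- by [].
- by apply: SB; [exact: hy | exact: hz].
- by apply: SV; [exact: hy | exact: hz].
Qed.

HB.instance Definition _ :=
  GRing.isDivringClosed.Build K adjoin_pred adjoin_divring.

Record adjoin := Adjoin {
  adjoin_val : K;
  adjoin_valP : adjoin_val \in adjoin_pred }.

HB.instance Definition _ := [isSub for adjoin_val].
HB.instance Definition _ := [Choice of adjoin by <:].
HB.instance Definition _ := [SubChoice_isSubIntegralDomain of adjoin by <:].
HB.instance Definition _ := [SubIntegralDomain_isSubField of adjoin by <:].

End RationalAdjoin.

(* Main.v *)
From HB Require Import structures.
Require Import Defs.
From mathcomp Require Import all_boot all_order all_algebra.
From mathcomp Require Import reals.
From mathcomp Require Import generic_quotient.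
From mathcomp Require Import boolp.
From mathcomp Require Import ring lra zify.

(** Write alpha_n for the complete quotients and a_n for the partial quotients,
    so that alpha_n = a_n + 1 / alpha_(n+1).  For n >= 1 the inverse of
    alpha_n is a remainder, hence |alpha_n| > 1; as |alpha_n - a_n| < 1, the
    non-negative rational a_n cannot be 0 and is therefore positive.

    A sequence of partial quotients determines the element it comes from
    ([cf_unique]): two expansions with the same partial quotients satisfy
    |x_n - y_n| = |x_(n+1) - y_(n+1)| / (|x_(n+1)| |y_(n+1)|), whose
    denominator is at least 2, while all the differences have absolute value
    less than 1.  Periodicity of the partial quotients thus gives
    alpha_(N+k) = alpha_N for some N >= 1.

    Unrolling one period writes beta = alpha_N as a fixed point of a Moebius
    transformation x |-> (A x + B) / (C x + D) whose coefficients are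
    non-negative rationals with C > 0, because the partial quotients are
    positive.  Hence C beta^2 + (D - A) beta - B = 0, with discriminant
    (A - D)^2 + 4 B C >= 0 ([periodic_cf_real_quadratic]).  This is the point
    where positivity of the Ruban partial quotients as real numbers forces the
    quadratic polynomial to have real roots.

    Being rational, or a root of a rational quadratic polynomial with
    non-negative discriminant, passes from x to a + 1/x
    ([real_quadratic_step]), so it descends from beta to alpha.  If alpha is
    irrational then 1, alpha is a basis of Q(alpha), and sending alpha to a real
    root of the same polynomial is a ring morphism
    ([adjoin_real_embedding]). *)

Set Implicit Arguments.
Unset Strict Implicit.
Unset Printing Implicit Defensive.

Import Order.TTheory GRing.Theory Num.Theory.
Local Open Scope ring_scope.


(** * The absolute value on Q_l *)

Section PadicAbs.
Variables (l : nat) (l_prime : prime l).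
Local Notation padic := (padic l_prime).

Lemma padic_abs_ge0 (x : padic) : 0 <= padic_abs x.
Proof.
rewrite leNgt; apply/negP; elim/quotW: x => u.
by move=> /padic_abs_eventually[]; rewrite ltxx.
Qed.

Lemma padic_abs0_eq0 (x : padic) : padic_abs x = 0 -> x = 0.
Proof.
elim/quotW: x => u u0; apply/padic_pi_eq0 => e e0.
have : padic_abs (\pi_(padic)%qT u) < e by rewrite u0.
move=> /padic_abs_eventually[_ [N [c ce uN]]].
by exists N => n /uN h; apply: le_lt_trans ce.
Qed.

Lemma padic_abs1 : padic_abs (1 : padic) = 1.
Proof. by rewrite -(rat_abs1 l_prime) -(padic_abs_rat l_prime) padic_ratrE rmorph1. Qed.

Lemma padic_abs0 : padic_abs (0 : padic) = 0.
Proof. by rewrite -(rat_abs0 l) -(padic_abs_rat l_prime) padic_ratrE rmorph0. Qed.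

Lemma padic_neq0 (x : padic) : 1 < padic_abs x -> x != 0.
Proof. by apply: contraTneq => ->; rewrite padic_abs0 ltr10. Qed.

Lemma rat_seq_limM (u v : nat -> rat) r s :
  rat_seq_lim u r -> rat_seq_lim v s -> rat_seq_lim (fun n => u n * v n) (r * s).
Proof.
move=> ur vs e e0.
have h1 : 0 < `|s| + `|r| + 1 by rewrite ltr_wpDl // addr_ge0.
pose d := Num.min 1 (e / (`|s| + `|r| + 1)).
have d0 : 0 < d by rewrite lt_min ltr01 divr_gt0.
have d1 : d <= 1 by rewrite ge_min lexx.
have de : d * (`|s| + `|r| + 1) <= e by rewrite -ler_pdivlMr // ge_min lexx orbT.
have [N uN] := ur d d0; have [N' vN] := vs d d0.
exists (maxn N N') => n; rewrite geq_max => /andP[/uN un /vN vn].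
have -> : u n * v n - r * s = (u n - r) * s + (v n - s) * r + (u n - r) * (v n - s).
  by ring.
apply: le_lt_trans (ler_normD _ _) _.
rewrite normrM.
have := ler_normD ((u n - r) * s) ((v n - s) * r); rewrite !normrM.
have h2 := normr_ge0 (u n - r); have h3 := normr_ge0 (v n - s).
have h4 := normr_ge0 s; have h5 := normr_ge0 r.
have k1 : `|u n - r| * `|s| <= d * `|s| by rewrite ler_wpM2r // ltW.
have k2 : `|v n - s| * `|r| <= d * `|r| by rewrite ler_wpM2r // ltW.
have k3 : `|u n - r| * `|v n - s| < d * 1 by rewrite ltr_pM // (lt_le_trans vn).
lra.
Qed.

Lemma padic_absM : {morph @padic_abs l l_prime : x y / x * y}.
Proof.
elim/quotW=> u; elim/quotW=> v; rewrite -rmorphM; apply: padic_abs_lim.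
move=> e /(rat_seq_limM (padic_absP u) (padic_absP v))[N uvN].
by exists N => n /uvN; rewrite -(rat_absM l_prime).
Qed.

Lemma padic_absV (x : padic) : x != 0 -> padic_abs x * padic_abs x^-1 = 1.
Proof. by move=> x0; rewrite -padic_absM divff // padic_abs1. Qed.

(** The value group is discrete: absolute values above 1 are bounded away from
    1, which is what makes the contraction factor in [cf_unique] uniform. *)
Lemma rat_abs_gt1 (q : rat) : 1 < rat_abs l q -> 2 <= rat_abs l q.
Proof.
rewrite /rat_abs; case: ifP => [_|_]; first by rewrite ltr10.
have l1 : 1 < l%:R :> rat by rewrite ltr1n prime_gt1.
rewrite -{1}(expr0z (l%:R : rat)) ltr_eXz2l // => h.
have : l%:R ^ 1 <= l%:R ^ (- rat_val l q) :> rat by rewrite ler_eXz2l //; lia.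
by apply: le_trans; rewrite expr1z ler_nat prime_gt1.
Qed.

(** By the ultrametric inequality, x has the same absolute value as a rational
    within distance 1. *)
Lemma padic_abs_gt1 (x : padic) : 1 < padic_abs x -> 2 <= padic_abs x.
Proof.
move=> x1; have [q xq] := padic_rat_dense x ltr01.
suff e : padic_abs x = rat_abs l q by rewrite e in x1 *; exact: rat_abs_gt1.
rewrite -(padic_abs_rat l_prime); apply/eqP; rewrite eq_le !leNgt.
apply/andP; split; apply/negP => h.
  by have := padic_absD_lt (lt_trans xq x1) h; rewrite subrK ltxx.
have xq' : padic_abs (- (x - ratr q)) < padic_abs (ratr q : padic).
  by rewrite padic_absN; apply: lt_trans h; apply: lt_trans x1.
by have := padic_absD_lt xq' h; rewrite opprB subrK ltxx.
Qed.

End PadicAbs.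

(** * Continued fraction expansions *)

(** One step of the algorithm changes the distance of two elements with the
    same partial quotient a exactly by the factor x y. *)
Lemma subr_cf_step (K : fieldType) (a x y : K) : x != 0 -> y != 0 ->
  x - y = - (((a + x^-1) - (a + y^-1)) * (x * y)).
Proof. by move=> x0 y0; field; rewrite x0 y0. Qed.


Section Expansion.
Variables (l : nat) (l_prime : prime l).
Local Notation padic := (padic l_prime).

(** The distance of x and y at least doubles at every step, and it never
    reaches 1; so it is 0. *)
Lemma cf_unique (a : nat -> rat) (x y : nat -> padic) :
    (forall n, padic_abs (x n - ratr (a n)) < 1) ->
    (forall n, padic_abs (y n - ratr (a n)) < 1) ->
    (forall n, x n = ratr (a n) + (x n.+1)^-1) ->
    (forall n, y n = ratr (a n) + (y n.+1)^-1) ->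
    (forall n, 1 < padic_abs (x n.+1)) -> (forall n, 1 < padic_abs (y n.+1)) ->
  x 0%N = y 0%N.
Proof.
move=> xa ya xS yS x1 y1.
have d1 n : padic_abs (x n - y n) < 1.
  have -> : x n - y n = (x n - ratr (a n)) + - (y n - ratr (a n)) by ring.
  by apply: padic_absD_lt => //; rewrite padic_absN.
have dS n : padic_abs (x n - y n) * 2 <= padic_abs (x n.+1 - y n.+1).
  have hx := padic_neq0 (x1 n); have hy := padic_neq0 (y1 n).
  rewrite (subr_cf_step (ratr (a n)) hx hy) -xS -yS.
  rewrite padic_absN !padic_absM ler_wpM2l ?padic_abs_ge0 //.
  have := padic_abs_gt1 (x1 n); have := y1 n; nra.
have dn n : padic_abs (x 0%N - y 0%N) * 2 ^+ n <= padic_abs (x n - y n).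
  elim: n => [|n IHn]; first by rewrite mulr1.
  by apply: le_trans (dS n); rewrite exprSr mulrA ler_wpM2r.
apply/eqP; rewrite -subr_eq0; apply/eqP/padic_abs0_eq0/eqP.
rewrite eq_le padic_abs_ge0 andbT leNgt; apply/negP => d0.
set d := padic_abs _ in dn d0.
pose n := Num.bound d^-1.
have := dn n; rewrite leNgt => /negP; apply; apply: lt_trans (d1 n) _.
have : d^-1 < n%:R.
  by apply: le_lt_trans (archi_boundP _); rewrite ?ler_norm // invr_ge0 ltW.
move=> /lt_trans h; rewrite -ltr_pdivrMl // mulr1; apply: h.
by rewrite -natrX ltr_nat ltn_expl.
Qed.

Lemma ruban_infiniteP (alpha : padic) : ruban_infinite alpha ->
  exists2 x : nat -> padic, x 0%N = alpha & forall n,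
    [/\ ruban_partial_quotient alpha n = Some (padic_floor (x n)),
        x n = ratr (padic_floor (x n)) + (x n.+1)^-1 &
        1 < padic_abs (x n.+1)].
Proof.
move=> inf.
have ex n : exists y, ruban_complete_quotient alpha n = Some y.
  move: (inf n); rewrite /ruban_partial_quotient.
  by case: ruban_complete_quotient => // y _; exists y.
have [x xP] := choice ex.
exists x => [|n]; first by have := xP 0%N => -[].
have := xP n.+1; rewrite /= xP; case: ifPn => // r0 -[<-].
split; first by rewrite /ruban_partial_quotient xP.
  by rewrite invrK addrCA subrr addr0.
have [_ _ _ r1] := padic_floorP (x n).
rewrite ltNge; apply/negP => v1.
have := ler_wpM2l (padic_abs_ge0 (x n - ratr (padic_floor (x n)))) v1.
by rewrite padic_absV // mulr1 leNgt r1.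
Qed.

Lemma padic_floor_gt0 (x : padic) : 1 < padic_abs x -> 0 < padic_floor x.
Proof.
move=> x1; have [_ a0 _ xa] := padic_floorP x.
rewrite lt_neqAle a0 andbT; apply: contraTneq xa => <-.
by rewrite padic_ratrE rmorph0 subr0 -leNgt ltW.
Qed.

End Expansion.

(** * Elements of degree two with non-negative discriminant *)

Section RealQuadratic.
Variables (K : fieldType) (iota : {rmorphism rat -> K}).

(** [t] and [n] are the trace and the norm of [x] when [x] is irrational.  The
    discriminant condition says that X^2 - t X + n has a root in every real
    closed field. *)
Definition real_quadratic (x : K) : Prop :=
  exists t n : rat, x ^+ 2 = iota t * x - iota n /\ 0 <= t ^+ 2 - 4 * n.

Lemma is_rationalP (x : K) : is_rational x <-> exists q, x = iota q.
Proof. by split=> -[q ->]; exists q; rewrite (fmorph_eq_rat iota). Qed.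

(** If x^2 = t x - n then 1/x has trace t/n and norm 1/n.  Inversion divides the
    discriminant by n^2 and translation preserves it. *)
Lemma real_quadratic_step (a : rat) (x : K) : x != 0 ->
  is_rational x \/ real_quadratic x ->
  is_rational (iota a + x^-1) \/ real_quadratic (iota a + x^-1).
Proof.
move=> x0 [/is_rationalP[q ->]|[t [n [xtn D]]]].
  by left; apply/is_rationalP; exists (a + q^-1); rewrite rmorphD fmorphV.
have [n0|n0] := eqVneq n 0.
  left; apply/is_rationalP; exists (a + t^-1); rewrite rmorphD fmorphV.
  congr (_ + _^-1); apply: (mulIf x0).
  by rewrite -expr2 xtn n0 rmorph0 subr0.
right; exists (t / n + 2 * a), (n^-1 + t / n * a + a ^+ 2); split; last first.
  have -> : (t / n + 2 * a) ^+ 2 - 4 * (n^-1 + t / n * a + a ^+ 2) =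
            (t ^+ 2 - 4 * n) / n ^+ 2 by field.
  by rewrite divr_ge0 // sqr_ge0.
have in0 : iota n != 0 by rewrite fmorph_eq0.
suff h : x^-1 ^+ 2 = iota t / iota n * x^-1 - (iota n)^-1.
  by rewrite sqrrD h; field; rewrite in0 x0.
have e : iota n = iota t * x - x ^+ 2 by rewrite xtn; ring.
apply: (mulfI in0); transitivity (iota t * x^-1 - 1).
  by rewrite e; field.
by field; rewrite in0 x0.
Qed.

Lemma real_quadratic_unroll (a : nat -> rat) (x : nat -> K) m :
    (forall n, x n.+1 != 0) -> (forall n, x n = iota (a n) + (x n.+1)^-1) ->
    is_rational (x m) \/ real_quadratic (x m) ->
  is_rational (x 0%N) \/ real_quadratic (x 0%N).
Proof.
move=> x0 xS; elim: m => // m IHm h; apply: IHm; rewrite xS.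
exact: real_quadratic_step.
Qed.

(** The discriminant of C x^2 + (D - A) x - B is (D - A)^2 + 4 B C. *)
Lemma mobius_fixed_real_quadratic (A B C D : rat) (x : K) :
    0 <= B -> 0 < C ->
    x * (iota C * x + iota D) = iota A * x + iota B ->
  real_quadratic x.
Proof.
move=> B0 C0 e; exists ((A - D) / C), (- (B / C)); split.
  have ic : iota C != 0 by rewrite fmorph_eq0 gt_eqF.
  apply: (mulfI ic); rewrite rmorphN !rmorphM rmorphB !fmorphV /= opprK.
  transitivity (x * (iota C * x + iota D) - iota D * x); first by ring.
  by rewrite e; field.
by rewrite mulrN opprK addr_ge0 ?sqr_ge0 // mulr_ge0 // divr_ge0 // ltW.
Qed.

(** The Moebius transformation taking x_(k+1) to x_0 is the composite of the
    maps z |-> a_n + 1/z, so its coefficients are built from the positive a_n by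
    sums and products. *)
Lemma periodic_cf_real_quadratic (a : nat -> rat) (x : nat -> K) k :
    (forall n, 0 < a n) -> (forall n, x n.+1 != 0) ->
    (forall n, x n = iota (a n) + (x n.+1)^-1) -> x k.+1 = x 0%N ->
  real_quadratic (x 0%N).
Proof.
move=> a0 x0 xS xk.
have [A [B [C [D [B0 C0 e]]]]] : exists A B C D : rat, [/\ 0 <= B, 0 < C &
    x 0%N * (iota C * x k.+1 + iota D) = iota A * x k.+1 + iota B].
  (* The induction also has to keep A and D non-negative. *)
  suff [A [B [C [D [A0 B0 C0 D0 e]]]]] : exists A B C D : rat,
     [/\ 0 <= A, 0 <= B, 0 < C, 0 <= D &
      x 0%N * (iota C * x k.+1 + iota D) = iota A * x k.+1 + iota B].
    by exists A, B, C, D.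
  elim: k {xk} => [|k [A [B [C [D [A0 B0 C0 D0 e]]]]]].
    exists (a 0%N), 1, 1, 0; split; rewrite ?(ltW (a0 _)) ?ltr01 ?ler01 //.
    by rewrite rmorph1 rmorph0 xS; field.
  exists (A * a k.+1 + B), A, (C * a k.+1 + D), C; split=> //.
  - by rewrite addr_ge0 // mulr_ge0 // ltW.
  - by rewrite ltr_pwDl // mulr_gt0.
  - exact: ltW.
  rewrite (xS k.+1) in e; rewrite !rmorphD !rmorphM /=.
  have /(congr1 (fun z => z * x k.+2)) := e => e'.
  transitivity (x 0%N * (iota C * (iota (a k.+1) + (x k.+2)^-1) + iota D) * x k.+2).
    by field.
  by rewrite e'; field.
by rewrite xk in e; apply: mobius_fixed_real_quadratic e.
Qed.

Section Irrational.
Variables (x : K) (t n : rat).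
Hypotheses (x_irr : ~ is_rational x) (xtn : x ^+ 2 = iota t * x - iota n).

Lemma irrational_free (u v u' v' : rat) :
  iota u + iota v * x = iota u' + iota v' * x -> (u = u') * (v = v').
Proof.
move=> e; suff ev : v = v'.
  by split=> //; move: e; rewrite ev => /addIr/fmorph_inj.
apply/eqP; rewrite -subr_eq0; apply/negPn/negP => d0; apply: x_irr.
apply/is_rationalP; exists ((u' - u) / (v - v')).
have id0 : iota (v - v') != 0 by rewrite fmorph_eq0.
rewrite fmorph_div; apply: (mulIf id0); rewrite divfK // !rmorphB /=.
transitivity (iota u + iota v * x - iota u - iota v' * x); first by ring.
by rewrite e; ring.
Qed.

(** The two roots of X^2 - t X + n are x and t - x, so a rational root would make
    x rational. *)
Lemma irrational_quadratic : is_quadratic_irrational x.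
Proof.
pose p : {poly rat} := 'X^2 - (t *: 'X - n%:P).
have sp : size p = 3%N.
  rewrite /p size_polyDl size_polyXn // size_polyN.
  apply: leq_ltn_trans (size_polyD _ _) _.
  rewrite size_polyN gtn_max (leq_ltn_trans (size_scale_leq _ _)) ?size_polyX //.
  exact: leq_ltn_trans (size_polyC_leq1 _) _.
exists p; split=> //.
- apply: cubic_irreducible => [|s]; first by rewrite sp.
  rewrite rootE /p !hornerE; apply/negP => /eqP sroot; apply: x_irr.
  have es : iota s ^+ 2 = iota t * iota s - iota n.
    by rewrite -rmorphXn -rmorphM -rmorphB; congr (iota _); lra.
  have /eqP : (x - iota s) * (x - iota (t - s)) = 0.
    transitivity ((x ^+ 2 - iota t * x) - (iota s ^+ 2 - iota t * iota s)).
      by rewrite rmorphB; ring.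
    by rewrite xtn es; ring.
  by rewrite mulf_eq0 !subr_eq0 => /orP[] /eqP h; apply/is_rationalP; eexists; exact: h.
have -> : map_poly ratr p = map_poly iota p.
  by apply: eq_map_poly => q; rewrite (fmorph_eq_rat iota).
rewrite rootE /p rmorphB rmorphB /= map_polyXn map_polyZ map_polyX map_polyC /=.
by rewrite !hornerE xtn; apply/eqP; ring.
Qed.

(** It is enough that the elements u + v x form a subfield.  Inverses come from
    the norm of w = u + v x, its product with the conjugate
    (u + v t) - v x; irrationality of x makes it nonzero. *)
Lemma adjoin_coord (y : adjoin x) :
  exists uv : rat * rat, adjoin_val y = iota uv.1 + iota uv.2 * x.
Proof.
pose S : {pred K} := fun z => `[< exists uv : rat * rat, z = iota uv.1 + iota uv.2 * x >].
suff Sd : divring_closed S.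
  have xS : x \in S by apply/asboolP; exists (0, 1); rewrite /= rmorph0 rmorph1; ring.
  by have /asboolP/(_ S Sd xS)/asboolP := adjoin_valP y.
have SM z w : z \in S -> w \in S -> z * w \in S.
  move=> /asboolP[[u v] /= ->] /asboolP[[u' v'] /= ->]; apply/asboolP.
  exists (u * u' - v * v' * n, u * v' + v * u' + v * v' * t) => /=.
  transitivity (iota u * iota u' + (iota u * iota v' + iota v * iota u') * x
     + iota v * iota v' * x ^+ 2); first by ring.
  by rewrite xtn !(rmorphB, rmorphD, rmorphM) /=; ring.
split=> [|z w /asboolP[[u v] /= ->] /asboolP[[u' v'] /= ->]|z w zS wS].
- by apply/asboolP; exists (1, 0); rewrite /= rmorph0 rmorph1; ring.
- by apply/asboolP; exists (u - u', v - v'); rewrite /= !rmorphB; ring.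
apply: SM => //; move: wS => /asboolP[[u v] /= ew]; apply/asboolP.
have [w0|w0] := eqVneq w 0.
  by exists (0, 0); rewrite /= w0 invr0 rmorph0; ring.
pose N := u ^+ 2 + u * v * t + v ^+ 2 * n.
have eN : w * (iota (u + v * t) - iota v * x) = iota N.
  transitivity (iota u ^+ 2 + iota u * iota v * iota t + iota v ^+ 2 * iota t * x
      - iota v ^+ 2 * x ^+ 2); first by rewrite ew !(rmorphD, rmorphM) /=; ring.
  by rewrite xtn /N !(rmorphD, rmorphM, rmorphXn) /=; ring.
have N0 : N != 0.
  apply: contra_neq w0 => N0; move: eN; rewrite N0 rmorph0.
  move=> /eqP; rewrite mulf_eq0 => /orP[/eqP//|/eqP w'0].
  have [e1 e2] : prod (u + v * t = 0) (- v = 0).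
    by apply: irrational_free; rewrite rmorphN mulNr w'0 rmorph0; ring.
  have v0 : v = 0 by lra.
  have u0 : u = 0 by move: e1; rewrite v0; lra.
  by rewrite ew u0 v0 rmorph0; ring.
exists ((u + v * t) / N, - v / N) => /=.
have iN0 : iota N != 0 by rewrite fmorph_eq0.
apply: (mulfI iN0); rewrite -{1}eN mulrAC divff // mul1r.
by rewrite !fmorph_div rmorphN /=; field.
Qed.

(** The coordinates of [adjoin_coord] are unique, so u + v x |-> u + v rho is
    well defined; it is multiplicative since rho satisfies the quadratic
    relation of x. *)
Lemma adjoin_real_embedding (R : rcfType) : 0 <= t ^+ 2 - 4 * n ->
  exists f : {rmorphism adjoin x -> R}, injective f.
Proof.
move=> D0.
pose j : {rmorphism rat -> R} := ratr.
pose rho : R := (j t + Num.sqrt (j (t ^+ 2 - 4 * n))) / 2.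
have rhotn : rho ^+ 2 = j t * rho - j n.
  have := sqr_sqrtr (_ : 0 <= j (t ^+ 2 - 4 * n)); rewrite /rho ler0q => /(_ D0).
  set s := Num.sqrt _; rewrite rmorphB rmorphXn rmorphM rmorph_nat => es.
  transitivity ((j t ^+ 2 + 2 * j t * s + s ^+ 2) / 4); first by field.
  by rewrite es; field.
have [c cP] := choice adjoin_coord.
have cE y u v : adjoin_val y = iota u + iota v * x -> ((c y).1 = u) * ((c y).2 = v).
  by move=> e; apply: irrational_free; rewrite -cP.
pose f (y : adjoin x) : R := j (c y).1 + j (c y).2 * rho.
have fE y u v : adjoin_val y = iota u + iota v * x -> f y = j u + j v * rho.
  by rewrite /f => /cE[-> ->].
have fB : zmod_morphism f.
  move=> y z; rewrite (fE (y - z) ((c y).1 - (c z).1) ((c y).2 - (c z).2)).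
    by rewrite /f !rmorphB; ring.
  have -> : adjoin_val (y - z) = adjoin_val y - adjoin_val z by [].
  by rewrite !cP !rmorphB; ring.
have fM : monoid_morphism f.
  split=> [|y z].
    rewrite (fE 1 1 0) ?rmorph0 ?rmorph1 ?mul0r ?addr0 //.
  rewrite (fE (y * z) ((c y).1 * (c z).1 - (c y).2 * (c z).2 * n)
    ((c y).1 * (c z).2 + (c y).2 * (c z).1 + (c y).2 * (c z).2 * t)).
    rewrite /f; transitivity (j (c y).1 * j (c z).1 +
      (j (c y).1 * j (c z).2 + j (c y).2 * j (c z).1) * rho
      + j (c y).2 * j (c z).2 * rho ^+ 2); last by ring.
    by rewrite rhotn !(rmorphB, rmorphD, rmorphM) /=; ring.
  have -> : adjoin_val (y * z) = adjoin_val y * adjoin_val z by [].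
  rewrite !cP; transitivity (iota (c y).1 * iota (c z).1 +
      (iota (c y).1 * iota (c z).2 + iota (c y).2 * iota (c z).1) * x
      + iota (c y).2 * iota (c z).2 * x ^+ 2); first by ring.
  by rewrite xtn !(rmorphB, rmorphD, rmorphM) /=; ring.
pose fBm := GRing.isZmodMorphism.Build _ _ f fB.
pose fMm := GRing.isMonoidMorphism.Build _ _ f fM.
pose F : {rmorphism adjoin x -> R} := HB.pack f fBm fMm.
by exists F; apply: fmorph_inj.
Qed.

End Irrational.
End RealQuadratic.

Theorem theorem1p2 (R : realType) (l : nat) (l_prime : prime l)
    (alpha : padic l_prime) (alpha_periodic : ruban_periodic alpha) :
  is_rational alpha \/
  (is_quadratic_irrational alpha /\
   exists f : {rmorphism adjoin alpha -> R}, injective f).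
Proof.
pose iota : {rmorphism rat -> padic l_prime} := padic_of_rat l_prime.
have [inf [N [k [k1 per]]]] := alpha_periodic.
have [x xalpha xP] := ruban_infiniteP inf.
have xS n : x n = iota (padic_floor (x n)) + (x n.+1)^-1.
  by rewrite (fmorph_eq_rat iota); have [] := xP n.
have x1 n : 1 < padic_abs (x n.+1) by have [] := xP n.
have x0 n : x n.+1 != 0 := padic_neq0 (x1 n).
(* The index N.+1 rather than N ensures a positive first partial quotient even
   when N = 0: alpha itself may have integral part 0. *)
have xk : x (N + k).+1 = x N.+1.
  have eqfl n : padic_floor (x (n + N + k).+1) = padic_floor (x (n + N).+1).
    have := per (n + N).+1 (leqW (leq_addl n N)); rewrite addSn.
    by have [-> _ _] := xP (n + N + k).+1; have [-> _ _] := xP (n + N).+1 => -[].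
  apply: (@cf_unique _ _ (fun n => padic_floor (x (n + N).+1))
    (fun n => x (n + N + k).+1) (fun n => x (n + N).+1)) => n //.
  - by rewrite -eqfl; have [] := padic_floorP (x (n + N + k).+1).
  - by have [] := padic_floorP (x (n + N).+1).
  - by rewrite -eqfl; have [] := xP (n + N + k).+1.
  - by have [] := xP (n + N).+1.
have tail : real_quadratic iota (x N.+1).
  apply: (@periodic_cf_real_quadratic _ iota (fun n => padic_floor (x (n + N).+1))
    (fun n => x (n + N).+1) k.-1) => [n|n|n|] //.
  - exact/padic_floor_gt0.
  - by rewrite prednK // addnC xk.
rewrite -xalpha; have := real_quadratic_unroll x0 xS (or_intror tail).
case=> [?|[t [n [xtn D0]]]]; first by left.
have [?|x_irr] := pselect (is_rational (x 0%N)); [by left | right].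
split; first exact: irrational_quadratic xtn.
exact: adjoin_real_embedding xtn R D0.
Qed.
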